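(* If a dagger category has dagger equalizers (of all parallel pairs of morphisms), dagger pullbacks (of all cospans) and finite dagger products (including the empty one), then it is indiscrete.
   Context: A dagger category is a category equipped with an identity-on-objects functor $\dagger\colon\mathbf{C}^{\mathrm{op}}\to\mathbf{C}$ satisfying $f^{\dagger\dagger}=f$. A morphism $f\colon A\to B$ is dagger monic if $f^\dagger f=\mathrm{id}_A$, and a partial isometry if $f=ff^\dagger f$. A category is indiscrete if there is exactly one morphism between any two objects. A class $\Omega$ of objects of $\mathbf{J}$ is weakly initial if every object of $\mathbf{J}$ receives a morphism from some object in $\Omega$. For a functor $D\colon\mathbf{J}\to\mathbf{C}$, a dagger limit of $(D,\Omega)$ is a limit $(L,l_A\colon L\to D(A))$ of $D$ such that $l_A$ is a partial isometry for all $A\in\Omega$ and $l_A^\dagger l_A l_B^\dagger l_B=l_B^\dagger l_B l_A^\dagger l_A$ for all $A,B\in\Omega$. A dagger limit of $D$ is a dagger limit of $(D,\Omega)$ for some weakly initial $\Omega$. Dagger products, dagger pullbacks and dagger equalizers are dagger limits of diagrams of the corresponding shapes (discrete categories, cospans $\bullet\to\bullet\leftarrow\bullet$, parallel pairs $\bullet\rightrightarrows\bullet$). Note that for a discrete category $\Omega$ necessarily consists of all objects, and for a cospan $A\to C\leftarrow B$ any weakly initial $\Omega$ contains the objects at $A$ and $B$. A dagger equalizer of $f,g\colon A\to B$ is equivalently an equalizer $e\colon E\to A$ that is dagger monic. The empty dagger product is a terminal object. *)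

(* Defs.v *)
From mathcomp Require Import ssreflect ssrfun ssrbool eqtype fintype.

Set Implicit Arguments.
Unset Strict Implicit.
Unset Printing Implicit Defensive.

Declare Scope dagcat_scope.
Delimit Scope dagcat_scope with dagcat.
Local Open Scope dagcat_scope.

Record category := Category {
  ob :> Type;
  hom : ob -> ob -> Type;
  idm : forall A, hom A A;
  compm : forall A B C, hom B C -> hom A B -> hom A C;
  compm_idl : forall A B (f : hom A B), compm (idm B) f = f;
  compm_idr : forall A B (f : hom A B), compm f (idm A) = f;
  compmA : forall A B C D (h : hom C D) (g : hom B C) (f : hom A B),
    compm h (compm g f) = compm (compm h g) f
}.

Notation "g ∘ f" := (compm g f)
  (at level 40, left associativity) : dagcat_scope.

Record functor (J C : category) := Functor {
  fob :> J -> C;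
  fmap : forall A B : J, hom A B -> hom (fob A) (fob B);
  fmap_id : forall A : J, fmap (idm A) = idm (fob A);
  fmap_comp : forall (X Y Z : J) (g : hom Y Z) (f : hom X Y),
    fmap (g ∘ f) = fmap g ∘ fmap f
}.

Record dagger_category := DaggerCategory {
  dcat :> category;
  dag : forall A B : dcat, hom A B -> hom B A;
  dag_id : forall A : dcat, dag (idm A) = idm A;
  dag_comp : forall (X Y Z : dcat) (g : hom Y Z) (f : hom X Y),
    dag (g ∘ f) = dag f ∘ dag g;
  dagK : forall (A B : dcat) (f : hom A B), dag (dag f) = f
}.

Notation "f ^†" := (dag f) (at level 2, format "f ^†") : dagcat_scope.

Definition partial_isometry (C : dagger_category) (A B : C) (f : hom A B) :=
  f = f ∘ f^† ∘ f.

Definition indiscrete (C : category) :=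
  forall A B : C, exists f : hom A B, forall g : hom A B, g = f.

Definition is_cone (J C : category) (D : functor J C) (L : C)
    (l : forall A : J, hom L (D A)) :=
  forall (A B : J) (f : hom A B), fmap D f ∘ l A = l B.

Definition is_limit (J C : category) (D : functor J C) (L : C)
    (l : forall A : J, hom L (D A)) :=
  is_cone l /\
  forall (X : C) (x : forall A : J, hom X (D A)), is_cone x ->
    exists! u : hom X L, forall A : J, l A ∘ u = x A.

Definition weakly_initial (J : category) (Omega : J -> Prop) :=
  forall B : J, exists2 A : J, Omega A & inhabited (hom A B).

Definition is_dagger_limit_on (J : category) (C : dagger_category)
    (D : functor J C) (Omega : J -> Prop) (L : C)
    (l : forall A : J, hom L (D A)) :=
  [/\ is_limit l,
      forall A : J, Omega A -> partial_isometry (l A)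
    & forall A B : J, Omega A -> Omega B ->
        (l A)^† ∘ l A ∘ (l B)^† ∘ l B = (l B)^† ∘ l B ∘ (l A)^† ∘ l A].

Definition is_dagger_limit (J : category) (C : dagger_category)
    (D : functor J C) (L : C) (l : forall A : J, hom L (D A)) :=
  exists2 Omega : J -> Prop, weakly_initial Omega & is_dagger_limit_on Omega l.

Definition has_dagger_limits (J : category) (C : dagger_category) :=
  forall D : functor J C,
    exists (L : C) (l : forall A : J, hom L (D A)), is_dagger_limit l.

(* Only identities: [i = j] is used with [I] a [finType], hence has at most one
   proof. *)
Definition discrete_category (I : Type) : category.
Proof.
refine (@Category I (fun i j => i = j) (fun i => erefl i)
  (fun i j k g f => etrans f g) _ _ _).
- by move=> i j f; case: j / f.
- by move=> i j f; case: j / f.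
- by move=> i j k l h g f; case: l / h.
Defined.

Inductive cospan_ob : Set := cospan_left | cospan_apex | cospan_right.

Definition cospan_hom (x y : cospan_ob) : Set :=
  match x, y with
  | cospan_left, (cospan_left | cospan_apex)
  | cospan_right, (cospan_right | cospan_apex)
  | cospan_apex, cospan_apex => unit
  | _, _ => Empty_set
  end.

Definition cospan_id (x : cospan_ob) : cospan_hom x x :=
  match x with cospan_left | cospan_apex | cospan_right => tt end.

Definition cospan_comp (x y z : cospan_ob) :
    cospan_hom y z -> cospan_hom x y -> cospan_hom x z :=
  match x, y, z with
  | cospan_left, cospan_left, (cospan_left | cospan_apex)
  | cospan_left, cospan_apex, cospan_apex
  | cospan_right, cospan_right, (cospan_right | cospan_apex)
  | cospan_right, cospan_apex, cospan_apex
  | cospan_apex, cospan_apex, cospan_apex => fun _ _ => tt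
  | _, cospan_left, cospan_right | _, cospan_right, cospan_left
  | _, cospan_apex, (cospan_left | cospan_right) =>
      fun g _ => match g with end
  | _, _, _ => fun _ f => match f with end
  end.

Definition cospan_category : category.
Proof.
refine (@Category cospan_ob cospan_hom cospan_id cospan_comp _ _ _).
- by case; case; case.
- by case; case; case.
- by case; case; case; case; case; case; case.
Defined.

(* [true] and [false] are the two parallel arrows. *)
Inductive parallel_ob : Set := parallel_src | parallel_tgt.

Definition parallel_hom (x y : parallel_ob) : Set :=
  match x, y with
  | parallel_src, parallel_tgt => bool
  | parallel_tgt, parallel_src => Empty_set
  | _, _ => unit
  end.

Definition parallel_id (x : parallel_ob) : parallel_hom x x :=
  match x with parallel_src | parallel_tgt => tt end.

Definition parallel_comp (x y z : parallel_ob) :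
    parallel_hom y z -> parallel_hom x y -> parallel_hom x z :=
  match x, y, z with
  | parallel_src, parallel_src, _ => fun g _ => g
  | _, parallel_tgt, parallel_tgt => fun _ f => f
  | _, parallel_tgt, parallel_src => fun g _ => match g with end
  | parallel_tgt, parallel_src, _ => fun _ f => match f with end
  end.

Definition parallel_category : category.
Proof.
refine (@Category parallel_ob parallel_hom parallel_id parallel_comp _ _ _).
- by case; case; case.
- by case; case; case.
- by case; case; case; case; case; case; case.
Defined.

Definition has_dagger_equalizers (C : dagger_category) :=
  has_dagger_limits parallel_category C.

Definition has_dagger_pullbacks (C : dagger_category) :=
  has_dagger_limits cospan_category C.

(* [I] may be empty ([void]), so this includes the terminal object. *)
Definition has_finite_dagger_products (C : dagger_category) :=
  forall I : finType, has_dagger_limits (discrete_category I) C.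

(* Main.v *)
Require Import Defs.
From mathcomp Require Import ssreflect ssrfun ssrbool fintype.

(** The proof derives [idm A = 0] for every object [A], where a zero morphism
    is one that factors through the terminal object [T]; the dagger makes [T]
    initial as well.

    Two consequences of dagger pullbacks cannot both hold for a nonzero object.
    - The pullback of [f] along an identity is the domain of [f], with
      projections [idm] and [f] up to a unitary.  Hence every morphism is a
      partial isometry ([partial_isometry_all]).
    - A pullback over [T] is a product whose projections are partial isometries
      with commuting supports.  Since [T] is a zero object, this forces it to be
      an orthogonal direct sum: [p ∘ p^† = idm], [q ∘ q^† = idm] and
      [q ∘ p^† = 0] ([product_coisometry_r], [product_orthogonal]).

    On the direct sum of [A] with itself, sums of morphisms make sense and
    matrices can be multiplied.  The diagonal is a partial isometry, so
    [1 + 1 = 1] on [A].  The matrix with rows [(1 1)] and [(0 1)] is a partial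
    isometry [f] too; but then [f ∘ f^† ∘ f] is the matrix with all entries [1],
    and comparing lower left entries gives [1 = 0] ([idm_eq_zero]).  The
    argument is phrased with tuples and daggers, so that addition of morphisms
    never has to be set up. *)

Set Implicit Arguments.
Unset Strict Implicit.
Unset Printing Implicit Defensive.

Local Open Scope dagcat_scope.

(** * Terminal objects and pullbacks as dagger limits *)

Definition is_terminal (C : category) (T : C) :=
  forall A : C, exists! f : hom A T, True.

Lemma has_terminal (C : dagger_category) :
  has_finite_dagger_products C -> exists T : C, is_terminal T.
Proof.
move=> hproducts.
have D : functor (discrete_category void) C.
  refine (@Functor (discrete_category void) C
    (fun v : void => match v with end)
    (fun v => match v with end) _ _); by case.
have [T [l [_ _ [[_ univ] _ _]]]] := hproducts void D.
exists T => A.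
have [|u [_ u_uniq]] := univ A (fun v : void => match v with end); first by case.
by exists u; split=> // v _; apply: u_uniq; case.
Qed.

(** Uniqueness of the mediating morphism is stated as joint monicity of the
    legs, the form in which it gets applied. *)
Definition is_dagger_pullback (C : dagger_category) (A B E : C)
    (f : hom A E) (g : hom B E) (L : C) (p : hom L A) (q : hom L B) :=
  [/\ f ∘ p = g ∘ q,
      forall (X : C) (x : hom X A) (y : hom X B), f ∘ x = g ∘ y ->
        exists2 u : hom X L, p ∘ u = x & q ∘ u = y,
      forall (X : C) (u v : hom X L), p ∘ u = p ∘ v -> q ∘ u = q ∘ v -> u = v,
      partial_isometry p /\ partial_isometry q
    & p^† ∘ p ∘ q^† ∘ q = q^† ∘ q ∘ p^† ∘ p].

Section Cospan.
Variables (C : dagger_category) (A B E : C) (f : hom A E) (g : hom B E).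

Let cospan_fob (x : cospan_ob) : C :=
  match x with
  | cospan_left => A
  | cospan_apex => E
  | cospan_right => B
  end.

Definition cospan_fmap (x y : cospan_ob) :
    cospan_hom x y -> hom (cospan_fob x) (cospan_fob y) :=
  match x, y with
  | cospan_left, cospan_left => fun=> idm A
  | cospan_left, cospan_apex => fun=> f
  | cospan_right, cospan_right => fun=> idm B
  | cospan_right, cospan_apex => fun=> g
  | cospan_apex, cospan_apex => fun=> idm E
  | cospan_left, cospan_right | cospan_right, cospan_left
  | cospan_apex, (cospan_left | cospan_right) => fun k => match k with end
  end.

Definition cospan_functor : functor cospan_category C.
Proof.
refine (@Functor cospan_category C cospan_fob cospan_fmap _ _).
- by case.
- by case; case; case=> //= k h; rewrite ?compm_idl ?compm_idr.
Defined.

(** The two feet receive no morphism from another object, so every weakly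
    initial class contains both of them: the conditions on a dagger limit
    always apply to both legs. *)
Lemma dagger_pullback_exists : has_dagger_pullbacks C ->
  exists (L : C) (p : hom L A) (q : hom L B), is_dagger_pullback f g p q.
Proof.
move=> /(_ cospan_functor) [L [l [Omega Omega_wi [[cone univ] pis comm]]]].
have Omega_l : Omega cospan_left.
  by have [[] Omega_x [//= k]] := Omega_wi cospan_left; case: k.
have Omega_r : Omega cospan_right.
  by have [[] Omega_x [//= k]] := Omega_wi cospan_right; case: k.
have cone_l : f ∘ l cospan_left = l cospan_apex.
  exact: (cone cospan_left cospan_apex tt).
have cone_r : g ∘ l cospan_right = l cospan_apex.
  exact: (cone cospan_right cospan_apex tt).
exists L, (l cospan_left), (l cospan_right).
split; last exact: (comm _ _ Omega_l Omega_r).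
- by rewrite cone_l cone_r.
- move=> X x y fxgy.
  pose z (i : cospan_ob) : hom X (cospan_fob i) :=
    match i with
    | cospan_left => x
    | cospan_apex => f ∘ x
    | cospan_right => y
    end.
  have [|u [lu _]] := univ X z.
    by case; case=> //= k; rewrite ?compm_idl //; case: k.
  by exists u; [exact: (lu cospan_left)|exact: (lu cospan_right)].
- move=> X u v eq_l eq_r.
  have [|w [_ w_uniq]] := univ X (fun i => l i ∘ v).
    by move=> i j k; rewrite compmA cone.
  rewrite -(w_uniq u) ?(w_uniq v) //; case=> //.
  by rewrite -cone_l -!compmA eq_l.
- by split; [exact: (pis _ Omega_l)|exact: (pis _ Omega_r)].
Qed.

End Cospan.

(** * Partial isometries from pullbacks *)

Lemma partial_isometry_split_epi (C : dagger_category) (A B : C)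
    (p : hom A B) (s : hom B A) :
  partial_isometry p -> p ∘ s = idm B -> p ∘ p^† = idm B.
Proof. by move=> pi_p ps; rewrite -[LHS]compm_idr -ps compmA -pi_p. Qed.

(** The leg over [A] of the pullback of [f] and [idm B] is a partial isometry
    and an isomorphism, hence unitary; [f] is the other leg up to it. *)
Lemma partial_isometry_all (C : dagger_category) (A B : C) (f : hom A B) :
  has_dagger_pullbacks C -> partial_isometry f.
Proof.
move=> /(dagger_pullback_exists f (idm B)).
move=> [L [p [q [fp_q univ jmono [pi_p pi_q] _]]]].
rewrite compm_idl in fp_q.
have [|u pu qu] := univ A (idm A) f; first by rewrite compm_idl compm_idr.
have up : u ∘ p = idm L.
  by apply: jmono; rewrite compm_idr compmA ?pu ?qu ?compm_idl.
have ppd : p ∘ p^† = idm A by apply: partial_isometry_split_epi pi_p pu.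
have u_dag : u = p^† by rewrite -[u]compm_idr -ppd compmA up compm_idl.
have f_q : f = q ∘ p^† by rewrite -qu u_dag.
rewrite /partial_isometry f_q dag_comp dagK.
by rewrite -!compmA (compmA p^† p) -u_dag up compm_idl !compmA -pi_q.
Qed.

(** * Zero morphisms and orthogonal products *)

Section Zero.
Variables (C : dagger_category) (T : C) (T_terminal : is_terminal T).

Lemma to_terminal_eq (A : C) (f g : hom A T) : f = g.
Proof. by have [t [_ t_uniq]] := T_terminal A; rewrite -(t_uniq f) ?(t_uniq g). Qed.

Definition is_zero (A B : C) (z : hom A B) :=
  exists (s : hom A T) (t : hom T B), z = t ∘ s.

(** Any two morphisms out of [T] agree since their daggers do. *)
Lemma is_zero_unique (A B : C) (z w : hom A B) : is_zero z -> is_zero w -> z = w.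
Proof.
move=> [s [t ->]] [s' [t' ->]].
rewrite (to_terminal_eq s s') -(dagK t) -(dagK t').
by rewrite (to_terminal_eq t^† t'^†).
Qed.

Lemma is_zero_exists (A B : C) : exists z : hom A B, is_zero z.
Proof.
have [s _] := T_terminal A; have [t _] := T_terminal B.
by exists (t^† ∘ s), s, t^†.
Qed.

Lemma is_zero_compl (A B D : C) (g : hom B D) (z : hom A B) :
  is_zero z -> is_zero (g ∘ z).
Proof. by move=> [s [t ->]]; exists s, (g ∘ t); rewrite compmA. Qed.

Lemma is_zero_compr (A B D : C) (z : hom B D) (g : hom A B) :
  is_zero z -> is_zero (z ∘ g).
Proof. by move=> [s [t ->]]; exists (s ∘ g), t; rewrite compmA. Qed.

Lemma is_zero_dag (A B : C) (z : hom A B) : is_zero z -> is_zero z^†.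
Proof. by move=> [s [t ->]]; exists t^†, s^†; rewrite dag_comp. Qed.

Section Product.
Variables (A B L : C) (a : hom A T) (b : hom B T) (p : hom L A) (q : hom L B).
Hypothesis pq_pullback : is_dagger_pullback a b p q.

Lemma product_pair (X : C) (x : hom X A) (y : hom X B) :
  exists2 u : hom X L, p ∘ u = x & q ∘ u = y.
Proof. by case: pq_pullback => _ univ _ _ _; apply/univ/to_terminal_eq. Qed.

Lemma product_coisometry_r : q ∘ q^† = idm B.
Proof.
have [z _] := is_zero_exists B A; have [i _ qi] := product_pair z (idm B).
case: pq_pullback => _ _ _ [_ pi_q] _.
exact: partial_isometry_split_epi pi_q qi.
Qed.

(** With [r := q ∘ p^†], commutation of the supports gives
    [r^† ∘ q = r^† ∘ r ∘ p].  Restricted along the injection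
    [(0, 1) : B -> L], the left side is [r^†] and the right side is zero. *)
Lemma product_orthogonal : is_zero (q ∘ p^†).
Proof.
have [z z0] := is_zero_exists B A; have [i pi qi] := product_pair z (idm B).
case: pq_pullback => _ _ _ [pi_p _] comm.
suff : is_zero (p ∘ q^†) by move/is_zero_dag; rewrite dag_comp dagK.
have -> : p ∘ q^† = p ∘ (p^† ∘ p ∘ q^† ∘ q) ∘ i.
  by rewrite !compmA -pi_p -compmA qi compm_idr.
by rewrite comm -!compmA pi; do 4!apply: is_zero_compl.
Qed.

End Product.

(** * Collapse of the category *)

(** Below, [diag] is the diagonal of [A ⊕ A], so that [diag^†] is the row
    [(1 1)], and [f] is the matrix with rows [(1 1)] and [(0 1)]. *)
Lemma idm_eq_zero (A : C) : has_dagger_pullbacks C -> is_zero (idm A).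
Proof.
move=> hpb; have [a _] := T_terminal A.
have [L [p [q pq]]] := dagger_pullback_exists a a hpb.
have jmono : forall X (u v : hom X L), p ∘ u = p ∘ v -> q ∘ u = q ∘ v -> u = v.
  by case: pq.
have qqd := product_coisometry_r pq.
have qpd := product_orthogonal pq.
have [diag p_diag q_diag] := product_pair pq (idm A) (idm A).
have diagd_p : diag^† ∘ p^† = idm A by rewrite -dag_comp p_diag dag_id.
have diagd_q : diag^† ∘ q^† = idm A by rewrite -dag_comp q_diag dag_id.
(* This is 1 + 1 = 1. *)
have diagd_diag : diag^† ∘ diag = idm A.
  rewrite -[LHS]compm_idl -p_diag -compmA (compmA diag).
  by rewrite -(partial_isometry_all diag hpb).
have [f pf qf] := product_pair pq diag^† q.
have f_diag : f ∘ diag = diag.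
  by apply: jmono; rewrite compmA ?pf ?qf ?diagd_diag ?p_diag.
have f_qd : f ∘ q^† = diag.
  by apply: jmono; rewrite compmA ?pf ?qf ?diagd_q ?qqd ?p_diag ?q_diag.
(* Both rows of [f ∘ f^†] are (1 1), so both rows of [f] are equal. *)
have row_p : p ∘ f = diag^† ∘ f.
  rewrite {1}(partial_isometry_all f hpb) !compmA pf.
  by rewrite -dag_comp f_diag.
have row_q : q ∘ f = diag^† ∘ f.
  rewrite {1}(partial_isometry_all f hpb) !compmA qf.
  by rewrite -[in RHS]f_qd dag_comp dagK.
have q_diagd : q = diag^† by rewrite -qf row_q -row_p pf.
by rewrite -diagd_p -q_diagd.
Qed.

End Zero.

Theorem theorem5p1 (C : dagger_category)
    (hequalizers : has_dagger_equalizers C)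
    (hpullbacks : has_dagger_pullbacks C)
    (hproducts : has_finite_dagger_products C) :
  indiscrete C.
Proof.
have [T T_terminal] := has_terminal hproducts.
move=> A B; have [z z0] := is_zero_exists T_terminal A B.
exists z => g; apply: (is_zero_unique T_terminal) z0.
by rewrite -[g]compm_idr; apply: is_zero_compl (idm_eq_zero T_terminal A hpullbacks).
Qed.
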